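(* Suppose that a group $G$ contains a finite-index subgroup $N$ having a series $$\{1\}=A_0\subseteq A_1\subseteq\dots\subseteq A_n=N$$ of normal subgroups of $G$ such that, for each $i\in\{1,\dots,n\}$, the quotient $A_i/A_{i-1}$ either satisfies a given outer (multilinear) commutator identity $w_i=1$ of weight $t_i$ or lies in a given radical class $\mathcal K_i$, where all these classes $\mathcal K_i$, except possibly $\mathcal K_1$, are also coradical. Then $G$ contains a characteristic finite-index subgroup $H$ with the same property, i.e. $H$ has a series $\{1\}=B_0\subseteq\dots\subseteq B_n=H$ of normal subgroups of $G$ such that, for each $i$, $B_i/B_{i-1}$ satisfies the same identity $w_i=1$, respectively lies in the same class $\mathcal K_i$; and moreover $$\log_2|G:H|\le f^{t-1}(\log_2|G:N|),$$ where $f^k$ is the $k$th iterate of the function $f(x)=x(x+1)$ (with $f^0$ the identity) and $t=\prod t_i$, the product being taken over those $i$ for which the condition on the $i$th quotient is an identity $w_i=1$.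
   Context: An outer (multilinear) commutator of weight 1 is a letter $x_i$; an outer commutator of weight $t>1$ is a word $w(x_1,\dots,x_t)=[u(x_1,\dots,x_r),v(x_{r+1},\dots,x_t)]$ in a free group, where $u,v$ are outer commutators of weights $r$ and $t-r$ (all letters distinct). An outer commutator identity of weight $t$ is an identity $w=1$ with $w$ an outer commutator of weight $t$. A radical (Fitting) class is an isomorphism-closed class of groups such that normal subgroups of groups in the class are in the class, and a group that is a product of two normal subgroups lying in the class is in the class. A coradical class (formation) is an isomorphism-closed class of groups closed under quotient groups and under subdirect products of two groups. *)

(* Defs.v *)
From HB Require Import structures.
From mathcomp Require Import all_boot all_order all_algebra.
From mathcomp Require Import reals exp.

Set Implicit Arguments.
Unset Strict Implicit.
Unset Printing Implicit Defensive.

Local Open Scope group_scope.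
Local Open Scope quotient_scope.

(* A (possibly infinite) group is a [groupType], a subgroup of G is a         *)
(* [groupClosed G], and a normal subgroup is a [normalClosed G].  Subgroups   *)
(* are boolean predicates; since [mathcomp.classical.boolp] turns any Prop    *)
(* into a bool and equips any type with a choiceType structure, this excludes *)
(* no group and no subgroup.                                                  *)
HB.mixin Record isNormalClosed (G : groupType) (S : {pred G}) := {
  gpredJr : forall x g : G, x \in S -> x ^ g \in S
}.

#[short(type="normalClosed")]
HB.structure Definition NormalClosed (G : groupType) :=
  {S of isNormalClosed G S & GroupClosed G S}.

Section Subgroup.
Variables (G : groupType) (S : groupClosed G).

Definition carrier : pred G := fun x => x \in S.

Lemma carrier_closed : group_closed carrier.
Proof. by split; [apply: gpred1 | apply: gpredF]. Qed.

Definition subgroup := {x : G | carrier x}.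

HB.instance Definition _ := SubChoice.on subgroup.
HB.instance Definition _ :=
  SubChoice_isSubGroup.Build G carrier subgroup carrier_closed.

End Subgroup.

Section Cosets.
Variables (G : groupType) (S : groupClosed G).

Definition lcoset_rel (x y : G) := x^-1 * y \in S.

Lemma lcoset_rel_refl : reflexive lcoset_rel.
Proof. by move=> x; rewrite /lcoset_rel mulVg gpred1. Qed.

Lemma lcoset_rel_sym : symmetric lcoset_rel.
Proof. by move=> x y; rewrite /lcoset_rel -gpredV invgM invgK. Qed.

Lemma lcoset_rel_trans : transitive lcoset_rel.
Proof.
move=> y x z xy yz; rewrite /lcoset_rel.
by rewrite -[z](mulVKg y) mulgA gpredM.
Qed.

Canonical lcoset_equiv :=
  EquivRel lcoset_rel lcoset_rel_refl lcoset_rel_sym lcoset_rel_trans.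

Definition lcosets := {eq_quot lcoset_equiv}%qT.

(* |G : S| = k; "S has finite index" is [exists k, has_index k].              *)
Definition has_index (k : nat) := exists f : lcosets -> 'I_k, bijective f.

End Cosets.

Section QuotientGroup.
Variables (G : groupType) (N : normalClosed G).

Definition quotient := lcosets N.

HB.instance Definition _ := Choice.on quotient.
HB.instance Definition _ := EqQuotient.on quotient.

Definition quotient_mul (X Y : quotient) : quotient :=
  \pi_quotient (repr X * repr Y).
Definition quotient_one : quotient := \pi_quotient 1.
Definition quotient_inv (X : quotient) : quotient := \pi_quotient (repr X)^-1.

Lemma quotient_eqP (x y : G) :
  reflect (\pi_quotient x = \pi_quotient y) (x^-1 * y \in N).
Proof. by rewrite -[_ \in N]/(lcoset_equiv N x y) -eqmodE; apply: eqP. Qed.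

Lemma quotient_repr (x : G) : x^-1 * repr (\pi_quotient x) \in N.
Proof. by apply/quotient_eqP; rewrite reprK. Qed.

Lemma quotient_mulE (x y : G) :
  quotient_mul (\pi_quotient x) (\pi_quotient y) = \pi_quotient (x * y).
Proof.
apply/esym/quotient_eqP.
set x' := repr _; set y' := repr _.
have -> : (x * y)^-1 * (x' * y') = (x^-1 * x') ^ y * (y^-1 * y').
  by rewrite /conjg invgM -!mulgA mulVKg.
by apply: gpredM; [apply: gpredJr|]; apply: quotient_repr.
Qed.

Lemma quotient_invE (x : G) :
  quotient_inv (\pi_quotient x) = \pi_quotient x^-1.
Proof.
apply/esym/quotient_eqP; set x' := repr _.
have -> : (x^-1)^-1 * x'^-1 = ((x^-1 * x')^-1) ^ x^-1.
  by rewrite /conjg invgM !invgK -!mulgA mulgV mulg1.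
by apply/gpredJr/gpredVr/quotient_repr.
Qed.

Lemma quotient_mulA : associative quotient_mul.
Proof.
elim/quotW=> x; elim/quotW=> y; elim/quotW=> z.
rewrite (quotient_mulE y z) (quotient_mulE x (y * z)).
by rewrite (quotient_mulE x y) (quotient_mulE (x * y) z) mulgA.
Qed.

Lemma quotient_mul1 : left_id quotient_one quotient_mul.
Proof. by elim/quotW=> x; rewrite (quotient_mulE 1 x) mul1g. Qed.

Lemma quotient_mulr1 : right_id quotient_one quotient_mul.
Proof. by elim/quotW=> x; rewrite (quotient_mulE x 1) mulg1. Qed.

Lemma quotient_mulV : left_inverse quotient_one quotient_inv quotient_mul.
Proof.
by elim/quotW=> x; rewrite (quotient_invE x) (quotient_mulE x^-1 x) mulVg.
Qed.

Lemma quotient_mulrV : right_inverse quotient_one quotient_inv quotient_mul.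
Proof.
by elim/quotW=> x; rewrite (quotient_invE x) (quotient_mulE x x^-1) mulgV.
Qed.

HB.instance Definition _ := isGroup.Build quotient
  quotient_mulA quotient_mul1 quotient_mulr1 quotient_mulV quotient_mulrV.

End QuotientGroup.

Section Factor.
Variables (G : groupType) (A : groupClosed G) (B : normalClosed G).

Definition restr : {pred subgroup A} := [pred x : subgroup A | val x \in B].

Lemma restr_mul : mulg_closed restr.
Proof. by move=> x y; rewrite !inE valM; apply: gpredM. Qed.

Lemma restr_one : 1 \in restr.
Proof. by rewrite inE val1 gpred1. Qed.

Lemma restr_inv : invg_closed restr.
Proof. by move=> x; rewrite !inE gmulfV; apply: gpredVr. Qed.

Lemma restr_normal (x g : subgroup A) : x \in restr -> x ^ g \in restr.
Proof. by rewrite !inE gmulfJ; apply: gpredJr. Qed.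

HB.instance Definition _ := isMulClosed.Build (subgroup A) restr restr_mul.
HB.instance Definition _ := isMul1Closed.Build (subgroup A) restr restr_one.
HB.instance Definition _ := isInvClosed.Build (subgroup A) restr restr_inv.
HB.instance Definition _ :=
  isNormalClosed.Build (subgroup A) restr restr_normal.

(* A / B when B is contained in A, and A / (A :&: B) in general.              *)
Definition factor : groupType := quotient restr.

End Factor.

Definition isomorphic (G H : groupType) :=
  exists f : {multiplicative G -> H}, bijective f.

Definition characteristic (G : groupType) (S : groupClosed G) :=
  forall f : {multiplicative G -> G}, bijective f ->
  forall x : G, (f x \in S) = (x \in S).

(* Outer commutators up to renaming of letters: the leaves of the tree, read  *)
(* from left to right, are the distinct letters x_1, ..., x_t.                *)
Inductive outer_comm := Letter | Comm of outer_comm & outer_comm.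

Fixpoint weight (w : outer_comm) : nat :=
  match w with
  | Letter => 1
  | Comm u v => (weight u + weight v)%N
  end.

(* Value of w at x_i := g (i - 1); only g 0, ..., g (weight w - 1) are used.  *)
Fixpoint word_value (G : groupType) (w : outer_comm) (g : nat -> G) : G :=
  match w with
  | Letter => g 0
  | Comm u v =>
      [~ word_value u g, word_value v (fun i => g (weight u + i)%N)]
  end.

Definition satisfies_identity (G : groupType) (w : outer_comm) :=
  forall g : nat -> G, word_value w g = 1.

Record radical_class (K : groupType -> Prop) : Prop := RadicalClass {
  radical_iso : forall G H : groupType, isomorphic G H -> K G -> K H;
  radical_normal : forall (G : groupType) (N : normalClosed G),
    K G -> K (subgroup N);
  radical_product : forall (G : groupType) (M N : normalClosed G),
    (forall g : G, exists2 x, x \in M & exists2 y, y \in N & g = x * y) ->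
    K (subgroup M) -> K (subgroup N) -> K G
}.

Record coradical_class (K : groupType -> Prop) : Prop := CoradicalClass {
  coradical_iso : forall G H : groupType, isomorphic G H -> K G -> K H;
  coradical_quotient : forall (G : groupType) (N : normalClosed G),
    K G -> K (quotient N);
  coradical_subdirect :
    forall (G1 G2 : groupType) (S : groupClosed (G1 * G2)%type),
    (forall x : G1, exists y : G2, (x, y) \in S) ->
    (forall y : G2, exists x : G1, (x, y) \in S) ->
    K G1 -> K G2 -> K (subgroup S)
}.

Inductive factor_condition :=
  | Identity of outer_comm
  | InClass of (groupType -> Prop).

Definition satisfies (c : factor_condition) (Q : groupType) : Prop :=
  match c with
  | Identity w => satisfies_identity Q w
  | InClass K => K Q
  end.

Definition is_radical (c : factor_condition) : Prop :=
  match c with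
  | Identity _ => True
  | InClass K => radical_class K
  end.

Definition is_coradical (c : factor_condition) : Prop :=
  match c with
  | Identity _ => True
  | InClass K => coradical_class K
  end.

(* Factor 1 in the product of the weights for the class conditions.           *)
Definition condition_weight (c : factor_condition) : nat :=
  match c with
  | Identity w => weight w
  | InClass _ => 1
  end.

(* A 0, ..., A n is a series from 1 to N of normal subgroups of G, where the  *)
(* i-th condition, counting from 0, is imposed on A (i + 1) / A i.            *)
Record series_of (G : groupType) (n : nat) (C : 'I_n -> factor_condition)
    (N : groupClosed G) (A : nat -> normalClosed G) : Prop := SeriesOf {
  series_bottom : forall x : G, (x \in A 0) = (x == 1);
  series_top : forall x : G, (x \in A n) = (x \in N);
  series_mono : forall (i : 'I_n) (x : G), x \in A i -> x \in A i.+1;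
  series_factor : forall i : 'I_n, satisfies (C i) (factor (A i.+1) (A i))
}.

Definition log2 (R : realType) (x : R) : R := (ln x / ln 2)%R.

Definition index_bound (R : realType) (x : R) : R := (x * (x + 1))%R.

(* Main.v *)
Require Import Defs.
From mathcomp Require Import all_boot all_order all_algebra.
From mathcomp Require Import reals exp.
From HB Require Import structures.
From mathcomp Require Import boolp.

(** A condition on the quotients of a series is encoded by a predicate on
    t-tuples of normal subgroups which is monotone, and stable under automorphisms
    and under products in every coordinate: an identity w asks that the values of w
    on M_1, ..., M_t lie in A, a class K asks that M / A belong to K, and these
    requirements are nested along the series, so that their arities multiply up to
    t = prod t_i.
    The diagonal tuple (N, ..., N) satisfies the predicate exactly when N has a
    series of the required kind.

    If H is the product of all automorphic images of N, a chain argument shows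
    that 1 + log_2 |G : N| images suffice; the intersection N' of these images
    satisfies log_2 |G : N'| <= f (log_2 |G : N|).  Monotonicity lets us replace N
    by one image in the first coordinate and by N' in the others, and stability
    under products then lets us put H in the first coordinate.  Repeating this
    with N' replaces all the coordinates in turn by characteristic subgroups;
    at the t-th step N' is no longer needed, hence the exponent t - 1. *)

Set Implicit Arguments.
Unset Strict Implicit.
Unset Printing Implicit Defensive.

Local Open Scope group_scope.

(** * Normal subgroups *)

Record group_prop (G : groupType) (P : G -> Prop) : Prop := GroupProp {
  group_prop1 : P 1;
  group_propM : forall x y, P x -> P y -> P (x * y);
  group_propV : forall x, P x -> P x^-1
}.

Section Subgroups.
Variables (G : groupType) (P : G -> Prop) (gP : group_prop P).

Definition asbool_pred : {pred G} := [pred x | `[< P x >]].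

Fact asbool_predM : mulg_closed asbool_pred.
Proof. by move=> x y /asboolP Px /asboolP Py; apply/asboolP/(group_propM gP). Qed.

Fact asbool_pred1 : 1 \in asbool_pred.
Proof. by apply/asboolP/(group_prop1 gP). Qed.

Fact asbool_predV : invg_closed asbool_pred.
Proof. by move=> x /asboolP Px; apply/asboolP/(group_propV gP). Qed.

Definition subgroup_of : groupClosed G :=
  HB.pack_for (groupClosed G) asbool_pred
    (isMulClosed.Build G asbool_pred asbool_predM)
    (isMul1Closed.Build G asbool_pred asbool_pred1)
    (isInvClosed.Build G asbool_pred asbool_predV).

Lemma subgroup_ofP x : reflect (P x) (x \in subgroup_of).
Proof. exact: asboolP. Qed.

Hypothesis PJ : forall x g, P x -> P (x ^ g).

Fact asbool_predJ x g : x \in asbool_pred -> x ^ g \in asbool_pred.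
Proof. by move=> /asboolP Px; apply/asboolP/PJ. Qed.

Definition normal_of : normalClosed G :=
  HB.pack_for (normalClosed G) asbool_pred
    (isMulClosed.Build G asbool_pred asbool_predM)
    (isMul1Closed.Build G asbool_pred asbool_pred1)
    (isInvClosed.Build G asbool_pred asbool_predV)
    (isNormalClosed.Build G asbool_pred asbool_predJ).

Lemma normal_ofP x : reflect (P x) (x \in normal_of).
Proof. exact: asboolP. Qed.

End Subgroups.

Section NormalOps.
Variable G : groupType.
Implicit Types X Y A B : normalClosed G.

Definition subN X Y := forall x : G, x \in X -> x \in Y.

Fact whole_group : group_prop (fun _ : G => True).
Proof. by split. Qed.

Definition whole : normalClosed G := normal_of whole_group (fun _ _ _ => I).

Lemma in_whole x : x \in whole.
Proof. exact/normal_ofP. Qed.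

Fact meet_group X Y : group_prop (fun x : G => x \in X /\ x \in Y).
Proof.
split=> [|x y [xX xY] [yX yY]|x [xX xY]]; first by rewrite !gpred1.
  by split; apply: gpredM.
by rewrite !gpredV.
Qed.

Fact meet_conj X Y x g : x \in X /\ x \in Y -> x ^ g \in X /\ x ^ g \in Y.
Proof. by case=> xX xY; split; apply: gpredJr. Qed.

Definition meetN X Y : normalClosed G := normal_of (meet_group X Y) (@meet_conj X Y).

Lemma meetNP X Y x : reflect (x \in X /\ x \in Y) (x \in meetN X Y).
Proof. exact: normal_ofP. Qed.

Lemma meetN_subl X Y : subN (meetN X Y) X.
Proof. by move=> x /meetNP[]. Qed.

Lemma meetN_subr X Y : subN (meetN X Y) Y.
Proof. by move=> x /meetNP[]. Qed.

Definition in_product X Y (z : G) :=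
  exists2 x, x \in X & exists2 y, y \in Y & z = x * y.

Fact join_group X Y : group_prop (in_product X Y).
Proof.
split=> [|z t [x xX [y yY ->]] [x' x'X [y' y'Y ->]]|z [x xX [y yY ->]]].
- by exists 1; [apply: gpred1|exists 1; [apply: gpred1|rewrite mulg1]].
- exists (x * x'); first exact: gpredM.
  exists (y ^ x' * y'); first by apply: gpredM => //; apply: gpredJr.
  by rewrite /conjg -!mulgA mulVKg.
- exists x^-1; first by rewrite gpredV.
  exists (y^-1 ^ x^-1); first by apply: gpredJr; rewrite gpredV.
  by rewrite /conjg invgK invgM mulKg.
Qed.

Fact join_conj X Y z g : in_product X Y z -> in_product X Y (z ^ g).
Proof.
case=> x xX [y yY ->]; exists (x ^ g); first exact: gpredJr.
by exists (y ^ g); [exact: gpredJr|rewrite conjMg].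
Qed.

Definition joinN X Y : normalClosed G := normal_of (join_group X Y) (@join_conj X Y).

Lemma joinNP X Y z : reflect (in_product X Y z) (z \in joinN X Y).
Proof. exact: normal_ofP. Qed.

Lemma joinN_subl X Y : subN X (joinN X Y).
Proof.
by move=> x xX; apply/joinNP; exists x => //; exists 1; rewrite ?gpred1 ?mulg1.
Qed.

Lemma joinN_subr X Y : subN Y (joinN X Y).
Proof.
by move=> y yY; apply/joinNP; exists 1; rewrite ?gpred1 //; exists y; rewrite ?mul1g.
Qed.

Lemma joinN_min X Y A : subN X A -> subN Y A -> subN (joinN X Y) A.
Proof.
by move=> XA YA z /joinNP[x /XA xA [y /YA yA ->]]; apply: gpredM.
Qed.

End NormalOps.

Section PartialMorphism.
Variables (G Q : groupType) (A : groupClosed G) (f : G -> Q).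
Hypothesis fM : {in A &, {morph f : x y / x * y}}.

Lemma pmorph1 : f 1 = 1.
Proof. by apply: (@mulgI _ (f 1)); rewrite -fM ?gpred1 // !mulg1. Qed.

Lemma pmorphV : {in A, {morph f : x / x^-1}}.
Proof.
move=> x xA; apply: (@mulgI _ (f x)).
by rewrite -fM ?gpredV // !mulgV pmorph1.
Qed.

Lemma pmorphJ : {in A &, {morph f : x y / x ^ y}}.
Proof.
by move=> x y xA yA; rewrite /conjg !fM ?pmorphV // ?gpredV ?gpredM.
Qed.

Lemma pmorphR : {in A &, {morph f : x y / [~ x, y]}}.
Proof.
by move=> x y xA yA; rewrite fM ?pmorphV ?pmorphJ // ?gpredV ?gpredJ.
Qed.

End PartialMorphism.

Section Preimage.
Variables (G : groupType) (phi : G -> G) (phiM : {morph phi : x y / x * y}).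
Variable X : normalClosed G.

Let phiM' : {in whole G &, {morph phi : x y / x * y}}.
Proof. by move=> x y _ _; apply: phiM. Qed.

Fact preim_group : group_prop (fun x : G => phi x \in X).
Proof.
split=> [|x y xX yX|x xX]; first by rewrite (pmorph1 phiM') gpred1.
  by rewrite phiM gpredM.
by rewrite (pmorphV phiM') ?in_whole // gpredV.
Qed.

Fact preim_conj x g : phi x \in X -> phi (x ^ g) \in X.
Proof. by move=> xX; rewrite (pmorphJ phiM') ?in_whole //; apply: gpredJr. Qed.

Definition preimN : normalClosed G := normal_of preim_group preim_conj.

Lemma in_preimN x : (x \in preimN) = (phi x \in X).
Proof. exact/normal_ofP/idP. Qed.

End Preimage.

(** * Factors of a series as homomorphic images *)

Section Onto.
Variable G : groupType.
Implicit Types (A : groupClosed G) (B : {pred G}).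

(** Presents [Q] as A / (A :&: B) by a function on all of [G], of which only the restriction to [A]
    matters. This keeps the arguments inside [G] instead of nested subgroup and quotient types. *)
Record onto A B (Q : groupType) (f : G -> Q) : Prop := Onto {
  ontoM : {in A &, {morph f : x y / x * y}};
  onto_surj : forall q, exists2 x, x \in A & f x = q;
  onto_ker : forall x, x \in A -> f x = 1 <-> x \in B
}.

Lemma onto_eq A B (Q : groupType) (f : G -> Q) : onto A B f ->
  {in A &, forall x y, f x = f y <-> x^-1 * y \in B}.
Proof.
move=> fo x y xA yA; have xyA : x^-1 * y \in A by rewrite gpredM ?gpredV.
rewrite -(onto_ker fo xyA) (ontoM fo) ?gpredV // (pmorphV (ontoM fo)) //.
by split=> [->|/(canRL (mulVKg _))]; rewrite ?mulVg ?mulg1.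
Qed.

(** On [A] the two maps have the same fibres, namely the cosets of A :&: B. So [f'] composed with
    any section of [f] is independent of the section and is an isomorphism. *)
Lemma onto_iso A B (Q Q' : groupType) (f : G -> Q) (f' : G -> Q') :
  onto A B f -> onto A B f' -> isomorphic Q Q'.
Proof.
move=> fo fo'.
have /choice[s sP] q : exists x, x \in A /\ f x = q.
  by have [x] := onto_surj fo q; exists x.
have /choice[s' s'P] q : exists x, x \in A /\ f' x = q.
  by have [x] := onto_surj fo' q; exists x.
pose h q := f' (s q); have hf x : x \in A -> h (f x) = f' x.
  move=> xA; have [sA sf] := sP (f x).
  by apply/(onto_eq fo') => //; apply/(onto_eq fo).
have hM : {morph h : x y / x * y}.
  move=> x y; have [[xA xf] [yA yf]] := (sP x, sP y).
  by rewrite -[in LHS]xf -[in LHS]yf -(ontoM fo) // hf ?gpredM // (ontoM fo').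
pose hh : {multiplicative Q -> Q'} :=
  HB.pack_for {multiplicative Q -> Q'} h (isMultiplicative.Build Q Q' h hM).
exists hh; exists (f \o s') => q.
  have [[sA sf] [tA tf]] := (sP q, s'P (h q)).
  by rewrite -[RHS]sf; apply/(onto_eq fo)/(onto_eq fo').
by have [qA qf] := s'P q; rewrite -[RHS]qf; apply: hf.
Qed.

(** [insubd] makes the projection total: elements outside [A] go to the class of 1. *)
Definition factor_map A (B : normalClosed G) (x : G) : factor A B :=
  \pi_(factor A B)%qT (insubd (1 : subgroup A) x).

Lemma onto_factor A (B : normalClosed G) : onto A B (@factor_map A B).
Proof.
split.
- move=> x y xA yA; rewrite -[RHS]/(quotient_mul _ _) quotient_mulE.
  congr (\pi_(factor A B)%qT _); apply: val_inj.
  by rewrite valM !val_insubd /carrier xA yA gpredM.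
- elim/quotW=> x; exists (val x); first exact: valP.
  by congr (\pi_(factor A B)%qT _); rewrite valKd.
- move=> x xA; have -> : x \in B = (1^-1 * insubd (1 : subgroup A) x \in @restr G A B).
    by rewrite inE invg1 mul1g val_insubd /carrier xA.
  split=> [fx1|xB]; first exact/quotient_eqP/esym/fx1.
  exact/esym/quotient_eqP.
Qed.

End Onto.

(** * Factors in radical and coradical classes *)

Section Classes.
Variables (G : groupType) (K : groupType -> Prop).
Hypothesis Kiso : forall Q Q' : groupType, isomorphic Q Q' -> K Q -> K Q'.
Implicit Types X Y A B : normalClosed G.

Lemma factor_classP (A : groupClosed G) B (Q : groupType) (f : G -> Q) :
  onto A B f -> K (factor A B) <-> K Q.
Proof.
by move=> fo; split; apply: Kiso; [apply: onto_iso fo | apply: onto_iso fo _];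
   apply: onto_factor.
Qed.

Lemma factor_class_ext X A A' : (forall x, x \in X -> (x \in A) = (x \in A')) ->
  K (factor X A) -> K (factor X A').
Proof.
move=> AA'; case: (onto_factor X A) => fM fs fk.
suff fo : onto X A' (@factor_map G X A).
  by move=> KX; apply/(factor_classP fo).
by split=> // x xX; rewrite -AA' // fk.
Qed.

End Classes.

(** Corestriction of [f] to its image: the class axioms speak of [subgroup S], so the map has to
    land in that type. *)
Lemma onto_image (G Q : groupType) (A : groupClosed G) (B : {pred G})
    (f : G -> Q) (S : groupClosed Q) :
  {in A &, {morph f : x y / x * y}} ->
  (forall x, x \in A -> f x = 1 <-> x \in B) ->
  (forall q, q \in S <-> exists2 x, x \in A & f x = q) ->
  onto A B (fun x => insubd (1 : subgroup S) (f x)).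
Proof.
move=> fM fk SP; have fS x : x \in A -> carrier S (f x) by move=> xA; apply/SP; exists x.
split.
- move=> x y xA yA; apply: val_inj.
  by rewrite valM !val_insubd !fS ?gpredM // fM.
- move=> q; have /SP[x xA fx] : val q \in S := valP q.
  by exists x => //; rewrite fx valKd.
- move=> x xA; rewrite -fk //; split=> [/(congr1 val)|fx1].
    by rewrite val_insubd fS // val1.
  by apply: val_inj; rewrite val_insubd fS // val1.
Qed.

(** Surjectivity is what makes the image normal: every conjugating element of [Q] lifts to [A]. *)
Lemma image_normal (G Q : groupType) (A : groupClosed G) (B : {pred G})
    (f : G -> Q) (X : normalClosed G) : onto A B f -> (forall x, x \in X -> x \in A) ->
  exists S : normalClosed Q, forall q, q \in S <-> exists2 x, x \in X & f x = q.
Proof.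
move=> [fM fs _] XA.
have Sg : group_prop (fun q => exists2 x, x \in X & f x = q).
  split=> [|_ _ [x xX <-] [y yX <-]|_ [x xX <-]].
  - by exists 1; [exact: gpred1|exact: pmorph1 fM].
  - by exists (x * y); [exact: gpredM|rewrite fM ?XA].
  - by exists x^-1; [rewrite gpredV|rewrite (pmorphV fM) ?XA].
have SJ q h : (exists2 x, x \in X & f x = q) -> exists2 x, x \in X & f x = q ^ h.
  case=> x xX <-; have [g gA <-] := fs h.
  by exists (x ^ g); [exact: gpredJr|rewrite (pmorphJ fM) // XA].
by exists (normal_of Sg SJ) => q; split=> [/normal_ofP//|fx]; apply/normal_ofP.
Qed.

Section RadicalClasses.
Variables (G : groupType) (K : groupType -> Prop) (radK : radical_class K).
Implicit Types X Y A B : normalClosed G.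

(** X' / (X' :&: A) is isomorphic to the image of [X'] in [factor X A], which is a normal subgroup
    there. *)
Lemma factor_class_sub X X' A : subN X' X -> K (factor X A) -> K (factor X' A).
Proof.
move=> X'X KX; have fo := onto_factor X A.
have [S SP] := image_normal fo X'X; case: fo => fM _ fk.
have X'fM := sub_in2 X'X fM.
have X'fk x X'x := fk x (X'X x X'x).
apply/(factor_classP (radical_iso radK) (onto_image X'fM X'fk SP)).
exact: radical_normal KX.
Qed.

(** The factor of the join is the product of the images of [X] and [Y], which are normal in it and
    isomorphic to [factor X A] and [factor Y A]. *)
Lemma factor_class_join X Y A :
  K (factor X A) -> K (factor Y A) -> K (factor (joinN X Y) A).
Proof.
move=> KX KY; have fo := onto_factor (joinN X Y) A.
have [sX sY] := (@joinN_subl _ X Y, @joinN_subr _ X Y).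
have [S SP] := image_normal fo sX; have [T TP] := image_normal fo sY.
case: (fo) => fM fs fk.
apply: (radical_product radK (M := S) (N := T)).
- move=> q; have [z /joinNP[x xX [y yY ->]] fz] := fs q.
  exists (@factor_map G (joinN X Y) A x).
    by apply/SP; exists x.
  exists (@factor_map G (joinN X Y) A y).
    by apply/TP; exists y.
  by rewrite -fz; apply: fM; [apply: sX|apply: sY].
- have XfM := sub_in2 sX fM; have Xfk x xX := fk x (sX x xX).
  exact/(factor_classP (radical_iso radK) (onto_image XfM Xfk SP)).
- have YfM := sub_in2 sY fM; have Yfk x xY := fk x (sY x xY).
  exact/(factor_classP (radical_iso radK) (onto_image YfM Yfk TP)).
Qed.

Lemma factor_class_aut X A (phi : G -> G) (phiM : {morph phi : x y / x * y}) :
  bijective phi -> K (factor X A) -> K (factor (preimN phiM X) (preimN phiM A)).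
Proof.
move=> [psi phiK psiK] KX; case: (onto_factor X A).
set f := @factor_map G X A => fM fs fk.
suff fo : onto (preimN phiM X) (preimN phiM A) (f \o phi).
  exact/(factor_classP (radical_iso radK) fo).
split.
- by move=> x y; rewrite !in_preimN => xX yX; rewrite /= phiM; apply: fM.
- move=> q; have [x xX <-] := fs q.
  by exists (psi x); [rewrite in_preimN psiK|rewrite /= psiK].
- by move=> x; rewrite !in_preimN => xX; apply: fk.
Qed.

End RadicalClasses.

Section CoradicalClasses.
Variables (G : groupType) (K : groupType -> Prop) (corK : coradical_class K).
Implicit Types X Y A B : normalClosed G.

(** [factor X A'] is the quotient of [factor X A] by the image of A' :&: X. *)
Lemma factor_class_quotient X A A' :
  subN A A' -> K (factor X A) -> K (factor X A').
Proof.
move=> AA' KX; have fo := onto_factor X A.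
have [T TP] := image_normal fo (@meetN_subr _ A' X).
suff qo : onto X A' (fun x => \pi_(quotient T)%qT
    (@factor_map G X A x) : quotient T).
  apply/(factor_classP (coradical_iso corK) qo).
  exact: coradical_quotient.
set f := @factor_map G X A in fo TP *.
split.
- move=> x y xX yX; rewrite -[RHS]/(quotient_mul _ _) quotient_mulE.
  by congr (\pi_(quotient T)%qT _); apply: (ontoM fo).
- elim/quotW=> q; have [x xX fx] := onto_surj fo q.
  by exists x => //; congr (\pi_(quotient T)%qT _).
- move=> x xX; have -> : x \in A' <-> f x \in T.
    rewrite TP; split=> [xA'|[y /meetNP[yA' yX] /(onto_eq fo)]].
      by exists x => //; apply/meetNP.
    by move=> /(_ yX xX)/AA' yx; rewrite -[x](mulVKg y) gpredM.
  have -> : f x \in T = (1^-1 * f x \in T) by rewrite invg1 mul1g.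
  split=> [fx1|xB]; first exact/quotient_eqP/esym/fx1.
  exact/esym/quotient_eqP.
Qed.

(** The map to [factor X A] times [factor X B] has kernel X :&: A :&: B, and its image is a
    subdirect product. *)
Lemma factor_class_meet X A B :
  K (factor X A) -> K (factor X B) -> K (factor X (meetN A B)).
Proof.
move=> KA KB.
case: (onto_factor X A) (onto_factor X B) KA KB.
move: (factor X A) (@factor_map G X A) => Q1 f1 f1M f1s f1k.
move: (factor X B) (@factor_map G X B) => Q2 f2 [f2M f2s f2k] KQ1 KQ2.
pose f x : Q1 * Q2 := (f1 x, f2 x).
have fM : {in X &, {morph f : x y / x * y}}.
  by move=> x y xX yX; rewrite /f f1M // f2M.
have Sg : group_prop (fun q => exists2 x, x \in X & f x = q).
  split=> [|_ _ [x xX <-] [y yX <-]|_ [x xX <-]].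
  - by exists 1; [exact: gpred1|exact: pmorph1 fM].
  - by exists (x * y); [exact: gpredM|rewrite fM].
  - by exists x^-1; [rewrite gpredV|rewrite (pmorphV fM)].
have SP q : q \in subgroup_of Sg <-> exists2 x, x \in X & f x = q.
  exact: iff_sym (rwP (subgroup_ofP Sg q)).
have fk x : x \in X -> f x = 1 <-> x \in meetN A B.
  move=> xX; split=> [[/f1k xA /f2k xB]|/meetNP[xA xB]].
    by apply/meetNP; split; [apply: xA|apply: xB].
  by rewrite /f (proj2 (f1k x xX)) // (proj2 (f2k x xX)).
apply/(factor_classP (coradical_iso corK) (onto_image fM fk SP)).
apply: coradical_subdirect KQ1 KQ2 => // q.
  by have [x xX <-] := f1s q; exists (f2 x); apply/SP; exists x.
by have [x xX <-] := f2s q; exists (f1 x); apply/SP; exists x.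
Qed.

End CoradicalClasses.

(** * Words evaluated on normal subgroups *)

Section WordValues.

Lemma weight_gt0 w : (0 < weight w)%N.
Proof. by elim: w => //= u IHu v _; rewrite addn_gt0 IHu. Qed.

Lemma eq_word_value (G : groupType) w (g h : nat -> G) :
  (forall i, (i < weight w)%N -> g i = h i) -> word_value w g = word_value w h.
Proof.
elim: w g h => [|u IHu v IHv] g h gh /=; first exact: gh.
rewrite (IHu g h) ?(IHv _ (fun i => h (weight u + i)%N)) // => i iv; apply: gh => /=.
  by rewrite ltn_add2l.
exact: ltn_addr.
Qed.

Lemma word_value_in (G : groupType) (A : groupClosed G) w (g : nat -> G) :
  (forall i, (i < weight w)%N -> g i \in A) -> word_value w g \in A.
Proof.
elim: w g => [|u IHu v IHv] g gA /=; first exact: gA.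
apply: gpredR; [apply: IHu|apply: IHv] => i iw; apply: gA => /=; last by rewrite ltn_add2l.
exact: ltn_addr.
Qed.

Lemma word_value_morph (G Q : groupType) (A : groupClosed G) (f : G -> Q) w
    (g : nat -> G) : {in A &, {morph f : x y / x * y}} ->
  (forall i, (i < weight w)%N -> g i \in A) ->
  f (word_value w g) = word_value w (f \o g).
Proof.
move=> fM; elim: w g => [//|u IHu v IHv] g gA /=.
have guA i : (i < weight u)%N -> g i \in A.
  by move=> iu; apply: gA; apply: ltn_addr.
have gvA i : (i < weight v)%N -> g (weight u + i)%N \in A.
  by move=> iu; apply: gA; rewrite /= ltn_add2l.
by rewrite (pmorphR fM) ?word_value_in // IHu ?IHv.
Qed.

Lemma word_valueJ (G : groupType) w (g : nat -> G) z :
  word_value w g ^ z = word_value w (fun i => g i ^ z).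
Proof.
have JM : {in whole G &, {morph conjg^~ z : x y / x * y}}.
  by move=> x y _ _; apply: conjMg.
by rewrite (word_value_morph JM) // => i _; apply: in_whole.
Qed.

End WordValues.

Section CentralizerModulo.
Variables (G : groupType) (T : G -> Prop) (B : normalClosed G).
Hypothesis TJ : forall x g, T x -> T (x ^ g).

Fact cent_group : group_prop (fun x : G => forall y, T y -> [~ x, y] \in B).
Proof.
split=> [y _|x x' xB x'B y Ty|x xB y Ty].
- by rewrite /commg /conjg mul1g mulVg mulg1 invg1 gpred1.
- have -> : [~ x * x', y] = [~ x, y] ^ x' * [~ x', y].
    by rewrite /commg /conjg invgM -!mulgA !mulVKg.
  by apply: gpredM; [apply/gpredJr/xB|apply: x'B].
- have -> : [~ x^-1, y] = ([~ x, y]^-1) ^ x^-1.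
    by rewrite /commg /conjg !invgM !invgK -!mulgA mulgV mulg1.
  by apply: gpredJr; rewrite gpredV xB.
Qed.

Fact cent_conj x g :
  (forall y, T y -> [~ x, y] \in B) -> forall y, T y -> [~ x ^ g, y] \in B.
Proof.
move=> xB y Ty; have -> : [~ x ^ g, y] = [~ x, y ^ g^-1] ^ g.
  rewrite /commg /conjg !invgM !invgK -!mulgA.
  by rewrite !(mulKg, mulVKg, mulVg, mulgV, mulg1).
exact/gpredJr/xB/TJ.
Qed.

(** [T] is only a set invariant under conjugation, since the values of a word need not form a
    subgroup; this is enough for its centralizer modulo [B] to be normal. *)
Definition centN : normalClosed G := normal_of cent_group cent_conj.

Lemma centNP x : reflect (forall y, T y -> [~ x, y] \in B) (x \in centN).
Proof. exact: normal_ofP. Qed.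

End CentralizerModulo.

Definition set_slot (T : Type) (M : nat -> T) (j : nat) (X : T) : nat -> T :=
  fun i => if i == j then X else M i.

Section WordOnSubgroups.
Variable G : groupType.
Implicit Types (M : nat -> normalClosed G) (X Y B : normalClosed G).

Definition word_sub w M B :=
  forall g : nat -> G, (forall i, (i < weight w)%N -> g i \in M i) -> word_value w g \in B.

Definition word_values w M (x : G) :=
  exists2 g, (forall i, (i < weight w)%N -> g i \in M i) & x = word_value w g.

Lemma word_valuesJ w M x z : word_values w M x -> word_values w M (x ^ z).
Proof.
case=> g gM ->; exists (fun i => g i ^ z); last exact: word_valueJ.
by move=> i iw; apply/gpredJr/gM.
Qed.

Lemma word_sub_comm u v M B :
  word_sub (Comm u v) M B <->
  forall x y, word_values u M x -> word_values v (fun i => M (weight u + i)%N) y ->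
    [~ x, y] \in B.
Proof.
split=> [MB x y [g gM ->] [h hM ->]|MB g gM]; last first.
  apply: MB; [exists g => // i iu|exists (fun i => g (weight u + i)%N) => // i iv].
    by apply: gM; apply: ltn_addr.
  by apply: gM; rewrite /= ltn_add2l.
(* The letters of [u] and [v] are distinct, so independent choices for the two sides glue into one
   tuple. *)
pose k i := if (i < weight u)%N then g i else h (i - weight u)%N.
rewrite (@eq_word_value _ u g k); last by move=> i iu; rewrite /k iu.
rewrite (@eq_word_value _ v h (fun i => k (weight u + i)%N)); last first.
  by move=> i iv; rewrite /k ltnNge leq_addr addKn.
apply: (MB k) => i /= iuv; rewrite /k; case: ltnP => ui; first exact: gM.
by rewrite -{2}(subnKC ui); apply: hM; rewrite ltn_subLR.
Qed.

(* Fixing the values of one side of a commutator turns the condition on the other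
   side into containment in a centralizer modulo B, which is normal in G: this
   makes induction on the word possible. *)
Lemma word_sub_centl u v M B :
  word_sub (Comm u v) M B <->
  word_sub u M (centN B (@word_valuesJ v (fun i => M (weight u + i)%N))).
Proof.
rewrite word_sub_comm; split=> [MB g gM|MB x y [g gM ->] yv].
  by apply/centNP => y yv; apply: MB => //; exists g.
by move/centNP: (MB g gM); apply.
Qed.

Lemma word_sub_centr u v M B :
  word_sub (Comm u v) M B <->
  word_sub v (fun i => M (weight u + i)%N) (centN B (@word_valuesJ u M)).
Proof.
have commV x y : [~ x, y] = [~ y, x]^-1 :> G.
  by rewrite /commg /conjg !invgM !invgK -!mulgA.
rewrite word_sub_comm; split=> [MB g gM|MB x y xu [g gM ->]].
  by apply/centNP => x xu; rewrite commV gpredV; apply: MB => //; exists g.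
by move/centNP: (MB g gM) => /(_ x xu); rewrite commV gpredV.
Qed.

Lemma word_sub_mono w M M' B : (forall i, (i < weight w)%N -> subN (M' i) (M i)) ->
  word_sub w M B -> word_sub w M' B.
Proof. by move=> M'M MB g gM'; apply: MB => i iw; apply: (M'M i iw); apply: gM'. Qed.

(** For a letter this is closure of [B] under products. For a commutator, the side without the
    letter [j] is absorbed into a centralizer modulo [B], and induction applies to the other side
    with that centralizer in place of [B]. *)
Lemma word_sub_join w M j X Y B : (j < weight w)%N ->
  word_sub w (set_slot M j X) B -> word_sub w (set_slot M j Y) B ->
  word_sub w (set_slot M j (joinN X Y)) B.
Proof.
elim: w M j B => [|u IHu v IHv] M j B.
  case: j => // _ XB YB g /(_ 0 isT) /joinNP[x xX [y yY /= ->]].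
  apply: gpredM; [apply: (XB (fun _ => x))|apply: (YB (fun _ => y))];
    by case.
move=> juv; have [ju|uj] := ltnP j (weight u).
  have slot Z i : set_slot M j Z (weight u + i)%N = M (weight u + i)%N.
    by rewrite /set_slot gtn_eqF // ltn_addr.
  move=> /word_sub_centl XB /word_sub_centl YB; apply/word_sub_centl.
  (* [D] is formed with the join in slot [j], but it involves only the slots of [v], so it is the
     same centralizer for [X] and for [Y]. *)
  set D := centN _ _.
  have toD Z : word_sub u (set_slot M j Z) (centN B
      (@word_valuesJ v (fun i => set_slot M j Z (weight u + i)%N))) ->
      word_sub u (set_slot M j Z) D.
    move=> ZB g /ZB /centNP gB; apply/centNP => y [h hM ->].
    by apply: gB; exists h => // i iv; move: (hM i iv); rewrite !slot.
  by move: XB YB => /toD XB /toD YB; apply: IHu.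
have jv : (j - weight u < weight v)%N by rewrite ltn_subLR.
have slot Z i : set_slot M j Z (weight u + i)%N =
    set_slot (fun i => M (weight u + i)%N) (j - weight u)%N Z i.
  by rewrite /set_slot -[in RHS](eqn_add2l (weight u)) subnKC.
have slot' Z i : (i < weight u)%N -> set_slot M j Z i = M i.
  by move=> iu; rewrite /set_slot ltn_eqF // (leq_trans iu).
move=> /word_sub_centr XB /word_sub_centr YB; apply/word_sub_centr.
set D := centN _ _.
have toD Z : word_sub v (fun i => set_slot M j Z (weight u + i)%N)
    (centN B (@word_valuesJ u (set_slot M j Z))) ->
    word_sub v (set_slot (fun i => M (weight u + i)%N) (j - weight u)%N Z) D.
  move=> ZB g gM; apply/centNP => y [h hM ->].
  have /centNP : word_value v g \in centN B (@word_valuesJ u (set_slot M j Z)).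
    by apply: ZB => i iv; rewrite slot; apply: gM.
  by apply; exists h => // i iu; move: (hM i iu); rewrite !slot'.
move: XB YB => /toD XB /toD YB.
by apply: word_sub_mono (IHv _ _ _ jv XB YB) => i iv x; rewrite slot.
Qed.

Lemma word_sub_aut w M B (phi : G -> G) (phiM : {morph phi : x y / x * y}) :
  word_sub w M B -> word_sub w (fun i => preimN phiM (M i)) (preimN phiM B).
Proof.
move=> MB g gM; have phiM' : {in whole G &, {morph phi : x y / x * y}}.
  by move=> x y _ _; apply: phiM.
rewrite in_preimN (word_value_morph phiM') => [|i _]; last exact: in_whole.
by apply: MB => i iw; move: (gM i iw); rewrite in_preimN.
Qed.

Lemma word_sub_factor w X B :
  word_sub w (fun _ => X) B <-> satisfies_identity (factor X B) w.
Proof.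
have fo := onto_factor X B; split=> [XB q|XB g gX].
  have /choice[g gq] i : exists x, x \in X /\ factor_map X B x = q i.
    by have [x] := onto_surj fo (q i); exists x.
  rewrite -(@eq_word_value _ w (@factor_map _ X B \o g)); last by move=> i _ /=; case: (gq i).
  rewrite -(word_value_morph (ontoM fo)); last by move=> i _; case: (gq i).
  apply/(onto_ker fo); first by apply: word_value_in => i _; case: (gq i).
  by apply: XB => i _; case: (gq i).
apply/(onto_ker fo); first exact: word_value_in.
by rewrite (word_value_morph (ontoM fo)).
Qed.

End WordOnSubgroups.

(** * Conditions on tuples of normal subgroups *)

Section Conditions.
Variables (G : groupType) (c : factor_condition).
Implicit Types (M : nat -> normalClosed G) (X Y A B : normalClosed G).

(** An identity uses one coordinate per letter and a class only coordinate 0, in accordance with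
    [condition_weight]. [A] need not lie in the coordinates; on a constant tuple this is the
    original condition on the factor. *)
Definition meets M A : Prop :=
  match c with
  | Identity w => word_sub w M A
  | InClass K => K (factor (M 0%N) A)
  end.

Lemma condition_weight_gt0 : (0 < condition_weight c)%N.
Proof. by case: c => [w|//]; apply: weight_gt0. Qed.

Lemma meets_factor X A : meets (fun _ => X) A <-> satisfies c (factor X A).
Proof. by rewrite /meets; case: c => [w|K] //=; apply: word_sub_factor. Qed.

Section Coradical.
Hypothesis corc : is_coradical c.

Lemma meets_weaken M A A' : subN A A' -> meets M A -> meets M A'.
Proof.
move: corc; rewrite /meets; case: c => [w _ AA' MA g gM|K corK] /=.
  exact/AA'/MA.
exact: factor_class_quotient.
Qed.

Lemma meets_meet M A B : meets M A -> meets M B -> meets M (meetN A B).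
Proof.
move: corc; rewrite /meets; case: c => [w _ MA MB g gM|K corK] /=.
  by apply/meetNP; split; [apply: MA|apply: MB].
exact: factor_class_meet.
Qed.

End Coradical.

Section Radical.
Hypothesis radc : is_radical c.

Lemma meets_eq X A A' : (forall x, x \in X -> (x \in A) = (x \in A')) ->
  meets (fun _ => X) A -> meets (fun _ => X) A'.
Proof.
move: radc; rewrite /meets; case: c => [w _ AA' XA g gX|K radK] /=.
  by rewrite -AA' ?XA // word_value_in.
exact: (factor_class_ext (radical_iso radK)).
Qed.

(** Stands in for [meets_weaken] at the bottom of the series, where the condition may fail to be
    coradical. *)
Lemma meets_ext M A A' : A =i A' -> meets M A -> meets M A'.
Proof.
move: radc; rewrite /meets; case: c => [w _ AA' XA g gX|K radK AA'] /=.
  by rewrite -AA'; apply: XA.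
by apply: (factor_class_ext (radical_iso radK)) => x _.
Qed.

Lemma meets_mono M M' A :
  (forall i, (i < condition_weight c)%N -> subN (M' i) (M i)) ->
  meets M A -> meets M' A.
Proof.
move: radc; rewrite /meets; case: c => [w _|K radK] /= M'M.
  exact: word_sub_mono.
exact: (factor_class_sub radK (M'M 0%N isT)).
Qed.

Lemma meets_join M j X Y A : (j < condition_weight c)%N ->
  meets (set_slot M j X) A -> meets (set_slot M j Y) A ->
  meets (set_slot M j (joinN X Y)) A.
Proof.
move: radc; rewrite /meets; case: c => [w _|K radK] /=.
  exact: word_sub_join.
by case: j => // _; apply: factor_class_join.
Qed.

Lemma meets_aut M A (phi : G -> G) (phiM : {morph phi : x y / x * y}) :
  bijective phi ->
  meets M A -> meets (fun i => preimN phiM (M i)) (preimN phiM A).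
Proof.
move: radc; rewrite /meets; case: c => [w _ _|K radK] /=.
  exact: word_sub_aut.
exact: factor_class_aut.
Qed.

End Radical.

End Conditions.

(** * Series as nested conditions on tuples *)

Section Layers.
Variables (G : groupType) (C : nat -> factor_condition).
Hypothesis radC : forall i, is_radical (C i).
Hypothesis corC : forall i, (0 < i)%N -> is_coradical (C i).
Implicit Types (M : nat -> normalClosed G) (X Y : normalClosed G).

Definition total_weight n := (\prod_(i < n) condition_weight (C i))%N.

Lemma total_weightS n : total_weight n.+1 = (total_weight n * condition_weight (C n))%N.
Proof. exact: big_ord_recr. Qed.

Lemma total_weight0 : total_weight 0 = 1%N.
Proof. exact: big_ord0. Qed.

Lemma total_weight_gt0 n : (0 < total_weight n)%N.
Proof. by apply: prodn_gt0 => i; apply: condition_weight_gt0. Qed.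

Definition row n M (i j : nat) := M (i * condition_weight (C n) + j)%N.

Lemma row_lt n i j : (i < total_weight n)%N -> (j < condition_weight (C n))%N ->
  (i * condition_weight (C n) + j < total_weight n.+1)%N.
Proof.
move=> i_lt j_lt; rewrite total_weightS.
apply: leq_trans (leq_mul i_lt (leqnn _)).
by rewrite mulSn addnC ltn_add2r.
Qed.

(* [layered n] is a condition on the coordinates [M i] with [i < total_weight n];
   the top condition [C n.-1] is applied to consecutive blocks of them, with an
   independent bottom [A i] for every block. *)
Fixpoint layered n M : Prop :=
  if n is n'.+1 then
    exists2 A : nat -> normalClosed G,
      forall i, (i < total_weight n')%N -> meets (C n') (row n' M i) (A i) &
      layered n' A
  else forall x, x \in M 0%N -> x = 1.

Lemma layered_mono n M M' : (forall i, (i < total_weight n)%N -> subN (M' i) (M i)) ->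
  layered n M -> layered n M'.
Proof.
case: n => [|n] M'M /=.
  by move=> M1 x /(M'M 0%N) x0; apply/M1/x0; rewrite total_weight0.
case=> A MA nA; exists A => // i ilt; apply: meets_mono (MA i ilt) => // j jlt.
exact/M'M/row_lt.
Qed.

Lemma layered_aut n M (phi : G -> G) (phiM : {morph phi : x y / x * y}) :
  bijective phi -> layered n M -> layered n (fun i => preimN phiM (M i)).
Proof.
move=> phib; elim: n M => [|n IHn] M.
  move=> M1 x; rewrite in_preimN => xM; have phix := M1 _ xM; apply: (bij_inj phib).
  have phiM' : {in whole G &, {morph phi : x y / x * y}} by move=> y z _ _; apply: phiM.
  by rewrite phix (pmorph1 phiM').
case=> A MA nA; exists (fun i => preimN phiM (A i)); last exact: IHn.
by move=> i ilt; exact: (meets_aut (radC n) phiM phib (MA i ilt)).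
Qed.

(** Only the block [i0] containing slot [j] changes. There the two bottoms are enlarged to their
    product, after which [X] and [Y] can be joined; in every other block the bottoms are replaced by
    their intersection. The new tuple of bottoms is handled by induction, with the product in slot
    [i0]. *)
Lemma layered_join n M j X Y : (j < total_weight n)%N ->
  layered n (set_slot M j X) -> layered n (set_slot M j Y) ->
  layered n (set_slot M j (joinN X Y)).
Proof.
elim: n M j X Y => [|n IHn] M j X Y; rewrite ?total_weight0.
  case: j => // _ X1 Y1 z /joinNP[x xX [y yY ->]].
  by rewrite (X1 x xX) (Y1 y yY) mulg1.
move=> jlt [A MA nA] [B MB nB].
set c := condition_weight (C n); have c0 : (0 < c)%N := condition_weight_gt0 _.
set i0 := (j %/ c)%N; have j0lt : (j %% c < c)%N by rewrite ltn_mod.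
have i0lt : (i0 < total_weight n)%N by rewrite ltn_divLR // -total_weightS.
have slot Z i k : (k < c)%N -> i != i0 ->
    row n (set_slot M j Z) i k = row n M i k.
  move=> kc ii0; rewrite /row /set_slot; case: eqP => // jE; case/eqP: ii0.
  by rewrite /i0 -jE divnMDl // divn_small // addn0.
have slot0 Z k : (k < c)%N ->
    row n (set_slot M j Z) i0 k = set_slot (row n M i0) (j %% c) Z k.
  by move=> kc; rewrite /row /set_slot {1}(divn_eq j c) eqn_add2l.
pose AB := joinN (A i0) (B i0).
exists (set_slot (fun i => meetN (A i) (B i)) i0 AB) => [i ilt|]; last first.
  apply: IHn => //.
    apply: layered_mono nA => i ilt; rewrite /set_slot.
    by case: eqP => [->//|_]; apply: meetN_subl.
  apply: layered_mono nB => i ilt; rewrite /set_slot.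
  by case: eqP => [->//|_]; apply: meetN_subr.
have [->|ii0] := eqVneq i i0.
  have -> : set_slot (fun i => meetN (A i) (B i)) i0 AB i0 = AB by rewrite /set_slot eqxx.
  apply: (@meets_mono _ _ _ (set_slot (row n M i0) (j %% c) (joinN X Y))) => //.
    by move=> k kc x; rewrite slot0.
  (* For positive [n] the condition is coradical and the bottom may grow. For [n = 0] the bottom is
     already equal to [AB], both being trivial. *)
  have enlarge D Z : subN D AB -> (n = 0%N -> subN AB D) ->
      meets (C n) (row n (set_slot M j Z) i0) D ->
      meets (C n) (set_slot (row n M i0) (j %% c) Z) AB.
    move=> DAB ABD ZD.
    apply: (@meets_mono _ _ _ (row n (set_slot M j Z) i0)) => //.
      by move=> k kc x; rewrite slot0.
    have [n0|n0] := posnP n; last exact: meets_weaken (corC n0) _ _ _ DAB ZD.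
    by apply: meets_ext ZD => // x; apply/idP/idP => [/DAB|/(ABD n0)].
  have triv : n = 0%N -> forall x, x \in AB -> x = 1.
    move=> n0; move: nA nB i0lt; rewrite n0 total_weight0 ltnS leqn0.
    rewrite /AB => A1 B1 /eqP ->.
    by move=> z /joinNP[x xA [y yB ->]]; rewrite (A1 x xA) (B1 y yB) mulg1.
  apply: meets_join => //; [apply: enlarge (MA _ i0lt)|apply: enlarge (MB _ i0lt)].
  - exact: joinN_subl.
  - by move=> /triv AB1 x /AB1 ->; apply: gpred1.
  - exact: joinN_subr.
  - by move=> /triv AB1 x /AB1 ->; apply: gpred1.
(* A second block exists, so [total_weight n] exceeds 1 and this is not the lowest layer; hence
   [C n] is coradical and bottoms can be intersected. *)
have n0 : (0 < n)%N.
  rewrite lt0n; apply: contraNneq ii0 => n0; move: ilt i0lt.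
  by rewrite n0 total_weight0 !ltnS !leqn0 => /eqP -> /eqP ->.
have -> : set_slot (fun i => meetN (A i) (B i)) i0 AB i = meetN (A i) (B i).
  by rewrite /set_slot (negPf ii0).
apply: (@meets_mono _ _ _ (row n M i)) => // [k kc x|]; first by rewrite slot.
apply: meets_meet; first exact: corC.
  by apply: meets_mono (MA i ilt) => // k kc x; rewrite slot.
by apply: meets_mono (MB i ilt) => // k kc x; rewrite slot.
Qed.

Lemma layered_of_series n (A : nat -> normalClosed G) :
  (forall x, x \in A 0%N -> x = 1) ->
  (forall i, (i < n)%N -> satisfies (C i) (factor (A i.+1) (A i))) ->
  layered n (fun _ => A n).
Proof.
move=> A0; elim: n => [//|n IHn] AC /=; exists (fun _ => A n).
  by move=> i _; apply/meets_factor/AC.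
by apply: IHn => i /ltnW; apply: AC.
Qed.

(** The bottoms may differ from block to block, but all blocks are equal to [X]; so the intersection
    of the finitely many bottoms serves for all of them. *)
Lemma layered_diagonal n X : layered n.+1 (fun _ => X) ->
  exists D : normalClosed G,
    [/\ subN D X, layered n (fun _ => D) & satisfies (C n) (factor X D)].
Proof.
case=> A XA nA.
have [D [DA XD]] : exists D, (forall i, (i <= (total_weight n).-1)%N -> subN D (A i)) /\
    meets (C n) (fun _ => X) D.
  have : ((total_weight n).-1 < total_weight n)%N.
    by rewrite prednK ?leqnn // total_weight_gt0.
  elim: (_.-1) => [|k IHk] klt.
    exists (A 0%N); split; last exact: XA.
    by move=> i; rewrite leqn0 => /eqP -> x.
  have [D [DA XD]] := IHk (ltnW klt).
  exists (meetN D (A k.+1)); split.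
    move=> i; rewrite leq_eqVlt => /predU1P[->|]; first exact: meetN_subr.
    by rewrite ltnS => /DA DAi x /meetNP[/DAi].
  apply: meets_meet XD (XA _ klt).
  (* A proper intersection step requires at least two blocks, which excludes [n = 0]. *)
  apply: corC; rewrite lt0n; apply/eqP => n0.
  by move: klt; rewrite n0 total_weight0.
(* Intersecting with [X] makes the term a subgroup of [X] and leaves the factor unchanged. *)
exists (meetN D X); split; first exact: meetN_subr.
  apply: layered_mono nA => i ilt x /meetNP[xD _]; apply: DA xD.
  by rewrite -ltnS prednK ?total_weight_gt0.
apply/meets_factor; apply: meets_eq XD => // x xX.
by apply/idP/meetNP => [|[]].
Qed.

Lemma series_of_layered n X : layered n (fun _ => X) ->
  exists B : nat -> normalClosed G,
    [/\ forall x, (x \in B 0%N) = (x == 1), B n = X,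
        forall i, (i < n)%N -> subN (B i) (B i.+1) &
        forall i, (i < n)%N -> satisfies (C i) (factor (B i.+1) (B i))].
Proof.
elim: n X => [|n IHn] X.
  move=> /= X1; exists (fun _ => X); split=> // x.
  by apply/idP/eqP => [/X1//|->]; apply: gpred1.
case/layered_diagonal => D [DX /IHn[B [B0 Bn Bm Bs]] XD].
exists (fun i => if (i <= n)%N then B i else X).
split=> // [|i|i]; first by rewrite ltnn.
  rewrite ltnS => iln; rewrite iln; have [->|ne] := eqVneq i n; first by rewrite ltnn Bn.
  by rewrite ltn_neqAle ne iln; apply: Bm; rewrite ltn_neqAle ne.
rewrite ltnS => iln; rewrite iln; have [->|ne] := eqVneq i n; first by rewrite ltnn Bn.
by rewrite ltn_neqAle ne iln; apply: Bs; rewrite ltn_neqAle ne.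
Qed.

End Layers.

(** * Finite index *)

Section Index.
Variable G : groupType.
Implicit Types (S : groupClosed G) (X Y : normalClosed G).

Lemma lcosets_eqP S (x y : G) :
  reflect (\pi_(lcosets S)%qT x = \pi_(lcosets S)%qT y) (x^-1 * y \in S).
Proof. by rewrite -[_ \in S]/(lcoset_equiv S x y) -eqmodE; apply: eqP. Qed.

Lemma bijective_of_surj (T U : Type) (f : T -> U) :
  injective f -> (forall u, exists t, f t = u) -> bijective f.
Proof.
move=> finj /choice[g gK]; exists g => // t.
by apply: finj; rewrite gK.
Qed.

Lemma has_indexP S k : has_index S k <->
  exists2 f : G -> 'I_k, forall i, exists x, f x = i &
    forall x y, f x = f y <-> x^-1 * y \in S.
Proof.
split=> [[h hbij]|[f fs fS]].
  exists (fun x => h (\pi_(lcosets S)%qT x)).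
    case: hbij => g gK hK i; exists (repr (g i)).
    by rewrite reprK hK.
  move=> x y; split=> [/(bij_inj hbij)/lcosets_eqP//|/lcosets_eqP ->//].
exists (fun c => f (repr c)); apply: bijective_of_surj => [c d /fS/lcosets_eqP|i].
  by rewrite !reprK.
have [x <-] := fs i; exists (\pi_(lcosets S)%qT x).
by apply/fS/lcosets_eqP; rewrite reprK.
Qed.

Lemma has_index_gt0 S k : has_index S k -> (0 < k)%N.
Proof. by case/has_indexP => f _ _; apply: leq_ltn_trans (ltn_ord (f 1)). Qed.

Lemma eq_has_index S S' k : S =i S' -> has_index S k -> has_index S' k.
Proof.
by move=> SS' /has_indexP[f fs fS]; apply/has_indexP; exists f => // x y; rewrite -SS'.
Qed.

(** An upper bound on the index, witnessed by a map that may split cosets and need not be onto.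
    Intersections and preimages then take one line each, and [index_le_has] recovers an exact
    index. *)
Definition index_le S k :=
  exists (T : finType) (f : G -> T),
    (#|T| <= k)%N /\ forall x y, f x = f y -> x^-1 * y \in S.

Lemma has_index_le S k : has_index S k -> index_le S k.
Proof.
by case/has_indexP => f _ fS; exists 'I_k, f; split=> [|x y /fS]; rewrite ?card_ord.
Qed.

Lemma index_le_has S k : index_le S k -> exists2 m, (m <= k)%N & has_index S m.
Proof.
case=> T [f [Tk fS]].
(* [f] may take several values on one coset; keeping its value at the representative gives exactly
   one label per coset. *)
pose I := [pred t : T | `[< exists c : lcosets S, f (repr c) = t >]].
have cI c : f (repr (c : lcosets S)) \in I by apply/asboolP; exists c.
exists #|I|; first exact: leq_trans (max_card _) Tk.
pose I0 := cI (\pi_(lcosets S)%qT 1).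
exists (fun c => enum_rank_in I0 (f (repr c))); apply: bijective_of_surj => [c d|i].
  move=> /(congr1 enum_val); rewrite !enum_rankK_in //.
  by move=> /fS/lcosets_eqP; rewrite !reprK.
have /asboolP[c fc] := enum_valP i; exists c.
by rewrite fc enum_valK_in.
Qed.

Lemma index_le_mono S S' k : (forall x, x \in S -> x \in S') -> index_le S k -> index_le S' k.
Proof.
by move=> SS' [T [f [Tk fS]]]; exists T, f; split=> // x y /fS/SS'.
Qed.

Lemma index_le_meet X Y k l : index_le X k -> index_le Y l -> index_le (meetN X Y) (k * l).
Proof.
move=> [T [f [Tk fX]]] [U [g [Ul gY]]].
exists (T * U)%type, (fun x => (f x, g x)); rewrite card_prod; split; first exact: leq_mul.
by move=> x y [/fX xX /gY xY]; apply/meetNP.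
Qed.

Lemma index_le_preim X k (phi : G -> G) (phiM : {morph phi : x y / x * y}) :
  index_le X k -> index_le (preimN phiM X) k.
Proof.
have phiM' : {in whole G &, {morph phi : x y / x * y}} by move=> x y _ _; apply: phiM.
move=> [T [f [Tk fX]]]; exists T, (f \o phi); split=> // x y /fX.
by rewrite in_preimN phiM (pmorphV phiM') ?in_whole.
Qed.

Lemma index_halved S S' k k' : has_index S k -> has_index S' k' ->
  (forall x, x \in S -> x \in S') -> forall z, z \in S' -> z \notin S -> (k'.*2 <= k)%N.
Proof.
move=> /has_indexP[f fs fS] /has_indexP[f' fs' fS'] SS' z zS' zS.
have /choice[r rK] := fs'.
(* Each coset of [S'] contains two distinct cosets of [S]: those of its representative [r i] and of
   [r i * z]. *)
pose h (p : 'I_k' * bool) := f (r p.1 * (if p.2 then z else 1)).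
have hinj : injective h.
  move=> [i b] [j c] /fS /= hij; have ij : i = j.
    rewrite -(rK i) -(rK j); apply/fS'; move: (SS' _ hij); rewrite invgM.
    have bS' (e : bool) : (if e then z else 1) \in S' by case: e; rewrite // gpred1.
    move=> ijS'; have -> : (r i)^-1 * r j =
        (if b then z else 1) * ((if b then z else 1)^-1 * (r i)^-1 *
          (r j * (if c then z else 1))) * (if c then z else 1)^-1.
      by rewrite !mulgA mulgV mul1g mulgK.
    by apply: gpredM; [apply: gpredM|rewrite gpredV].
  move: hij; rewrite ij invgM -mulgA mulKg.
  case: b c => [] [] //; rewrite ?invg1 ?mulg1 ?mul1g ?gpredV (negPf zS) //.
by have := leq_card h hinj; rewrite card_prod !card_ord card_bool muln2.
Qed.

End Index.

(** * Characteristic closure *)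

Section Closure.
Variable G : groupType.
Implicit Types (X Y N M D H : normalClosed G).

(* M is a product of automorphic images of N that contain D.  Preimages stand for
   images, as the automorphisms form a group. *)
Definition generated N D M :=
  forall Q : normalClosed G -> Prop,
  (forall X Y, Q X -> Q Y -> Q (joinN X Y)) ->
  (forall (phi : G -> G) (phiM : {morph phi : x y / x * y}), bijective phi ->
     subN D (preimN phiM N) -> Q (preimN phiM N)) ->
  Q M.

(** As long as some automorphic image of [N] is not contained in [M], adjoining it at least halves
    the index of [M]; hence at most log_2 m steps. Each step also intersects [D] with that image,
    which multiplies the index bound by at most [k]. *)
Lemma generated_saturate N k m M D d :
  has_index N k -> has_index M m -> index_le D d -> generated N D M ->
  exists s H D',
    [/\ (2 ^ s <= m)%N, subN M H, subN D' D, index_le D' (d * k ^ s) &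
        generated N D' H /\
        forall (phi : G -> G) (phiM : {morph phi : x y / x * y}), bijective phi ->
          subN (preimN phiM N) H].
Proof.
move=> Nk; elim/ltn_ind: m M D d => m IHm M D d Mm Dd genM.
have [ex|noz] := EM (exists phi : G -> G,
    exists phiM : {morph phi : x y / x * y},
      bijective phi /\ exists2 z, z \in preimN phiM N & z \notin M); last first.
  exists 0%N, M, D; split=> //; rewrite ?expn0 ?muln1 ?(has_index_gt0 Mm) //.
  split=> // phi phiM phib x xN; apply/negPn/negP => xM; case: noz.
  by exists phi, phiM; split=> //; exists x.
case: ex => phi [phiM [phib [z zN zM]]].
pose M1 := joinN M (preimN phiM N); pose D1 := meetN D (preimN phiM N).
have MM1 : subN M M1 by apply: joinN_subl.
have [m1 _ M1m1] := index_le_has (index_le_mono MM1 (has_index_le Mm)).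
have m1m : (m1.*2 <= m)%N.
  by apply: (index_halved Mm M1m1 MM1 _ zM); apply: joinN_subr.
have D1d : index_le D1 (d * k) := index_le_meet Dd (index_le_preim _ (has_index_le Nk)).
(* Images that contain [D] also contain the smaller [D1], and the new image contains [D1] by
   construction. *)
have gen1 : generated N D1 M1.
  move=> Q Qjoin Qphi; apply: (Qjoin M); last first.
    by apply: (Qphi phi phiM phib); apply: meetN_subr.
  apply: genM => // psi psiM psib Dpsi; apply: (Qphi psi psiM psib) => x /meetNP[xD _].
  exact: Dpsi.
have m1_lt : (m1 < m)%N.
  by apply: leq_trans m1m; rewrite -addnn -addn1 leq_add2l (has_index_gt0 M1m1).
have [s [H [D' [sm M1H D'D1 D'd [genH Hphi]]]]] := IHm m1 m1_lt M1 D1 _ M1m1 D1d gen1.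
exists s.+1, H, D'; split=> //.
- by apply: leq_trans m1m; rewrite expnS mul2n leq_double.
- by move=> x /MM1/M1H.
- by move=> x /D'D1/meetNP[].
- by rewrite expnS mulnA.
Qed.

Lemma characteristic_closure N k : has_index N k ->
  exists H D s,
    [/\ characteristic H, subN N H, subN D N,
        (2 ^ s <= k)%N /\ index_le D (k ^ s.+1) & generated N D H].
Proof.
(* [generated] speaks of preimages only, so [N] enters as its preimage under the identity, which has
   the same elements. *)
move=> Nk; have idM : {morph (@id G) : x y / x * y} by [].
have Nid : N =i preimN idM N by move=> x; rewrite in_preimN.
have gen0 : generated N N (preimN idM N).
  move=> Q _; apply; first by exists id.
  by move=> x; rewrite -Nid.
have [s [H [D [sk NH DN Dk [genH Hphi]]]]] :=
  generated_saturate Nk (eq_has_index Nid Nk) (has_index_le Nk) gen0.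
exists H, D, s; split=> //; last by split; rewrite // expnS.
  have stable (f g : G -> G) : {morph f : x y / x * y} -> cancel f g -> cancel g f ->
      forall x, x \in H -> f x \in H.
    move=> fM fK gK.
    (* It suffices to treat the generating images: [f] carries the preimage of [N] under [phi] into
       the preimage under [phi \o g], again contained in [H]. *)
    suff HfH : subN H (preimN fM H) by move=> x /HfH; rewrite in_preimN.
    apply: (genH (fun X => subN X (preimN fM H))) => [X Y|phi phiM phib _ x].
      exact: joinN_min.
    have gM : {morph g : x y / x * y}.
      by move=> y z; apply: (canLR fK); rewrite fM !gK.
    have pgM : {morph phi \o g : x y / x * y} by move=> y z /=; rewrite gM phiM.
    have pgb : bijective (phi \o g) by apply: bij_comp phib _; exists f.
    rewrite !in_preimN => xN; apply: (Hphi _ pgM pgb).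
    by rewrite in_preimN /= fK.
  move=> f [g fK gK] x.
  have fM : {morph f : x y / x * y} by apply: gmulfM.
  have gM : {morph g : x y / x * y}.
    by move=> y z; apply: (canLR fK); rewrite fM !gK.
  by apply/idP/idP => [/(stable g f gM gK fK)|/(stable f g fM fK gK)]; rewrite ?fK.
by move=> x xN; apply: NH; rewrite -Nid.
Qed.

End Closure.

(** * Binary logarithms and the function f *)

Section Log2.
Variable R : realType.
Local Open Scope ring_scope.
Import Order.TTheory GRing.Theory Num.Theory.

Lemma ln2_gt0 : 0 < ln (2 : R).
Proof. by apply: ln_gt0; rewrite ltr1n. Qed.

Lemma ler_log2 (m k : nat) : (0 < m)%N -> (m <= k)%N ->
  log2 (m%:R : R) <= log2 k%:R.
Proof.
move=> m0 mk; rewrite /log2 ler_pM2r ?invr_gt0 ?ln2_gt0 //.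
by rewrite ler_ln ?posrE ?ltr0n ?ler_nat // (leq_trans m0).
Qed.

Lemma log2_ge0 (k : nat) : (0 < k)%N -> 0 <= log2 (k%:R : R).
Proof.
by move=> k0; rewrite /log2 divr_ge0 ?(ltW ln2_gt0) // ln_ge0 // ler1n.
Qed.

Lemma log2X (k s : nat) : (0 < k)%N -> log2 ((k ^ s)%:R : R) = s%:R * log2 k%:R.
Proof.
by move=> k0; rewrite /log2 natrX lnXn ?ltr0n // mulrA mulr_natl.
Qed.

(** This is where f(x) = x(x+1) comes from: log_2 m is at most (s + 1) log_2 k, and s is at most
    log_2 k. *)
Lemma log2_index_bound (m k s : nat) : (0 < m)%N -> (2 ^ s <= k)%N ->
  (m <= k ^ s.+1)%N -> log2 (m%:R : R) <= index_bound (log2 k%:R).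
Proof.
move=> m0 sk mk; have k0 : (0 < k)%N by apply: leq_trans sk; rewrite expn_gt0.
apply: le_trans (ler_log2 m0 mk) _; rewrite log2X // /index_bound mulrC.
apply: ler_wpM2l; first exact: log2_ge0.
rewrite -natr1 lerD2r; apply: le_trans (ler_log2 _ sk); last by rewrite expn_gt0.
by rewrite log2X // /log2 divff ?mulr1 // gt_eqF // ln2_gt0.
Qed.

Lemma index_bound_mono (x y : R) : 0 <= x -> x <= y -> index_bound x <= index_bound y.
Proof.
move=> x0 xy; rewrite /index_bound ler_pM ?lerD2r // addr_ge0 //.
Qed.

End Log2.

(** * Replacing the coordinates by characteristic subgroups *)

Section Iteration.
Variables (R : realType) (G : groupType) (C : nat -> factor_condition).
Hypothesis radC : forall i, is_radical (C i).
Hypothesis corC : forall i, (0 < i)%N -> is_coradical (C i).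
Implicit Types (D H N : normalClosed G).

Definition mixed H D (s i : nat) : normalClosed G := if (i < s)%N then H else D.

(** [H'] is a product of automorphic images of [D] and [D'] lies in all of these images. An
    automorphism applied to the whole tuple fixes [H] and puts an image of [D] in slot [s]; the
    later slots shrink to [D'], and the images in slot [s] are then joined. *)
Lemma closure_step n s H D k : (s < total_weight C n)%N ->
  characteristic H -> has_index D k -> subN D H -> layered C n (mixed H D s) ->
  exists H' D' l,
    [/\ characteristic H', has_index D' l /\ (log2 (l%:R : R) <= index_bound (log2 k%:R))%R,
        subN D H', subN D' H' & layered C n (mixed H' D' s.+1)].
Proof.
move=> st Hchar Dk DH HDs.
have [H' [D' [r [H'char DH' D'D [rk D'le] gen]]]] := characteristic_closure Dk.
have [l lk D'l] := index_le_has D'le.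
exists H', D', l; split=> //.
- by split=> //; apply: log2_index_bound rk lk; apply: has_index_gt0 D'l.
- by move=> x /D'D/DH'.
have stableH (phi : G -> G) (phiM : {morph phi : x y / x * y}) :
    bijective phi -> forall x, (phi x \in H) = (x \in H).
  move=> phib x; pose f : {multiplicative G -> G} :=
    HB.pack_for {multiplicative G -> G} phi (isMultiplicative.Build G G phi phiM).
  exact: (Hchar f phib).
(* Thanks to this inclusion [H'] can also replace [H] in the first [s] slots, so that a single
   characteristic subgroup remains. *)
have H'H : subN H' H.
  apply: (gen (fun X => subN X H)) => [X Y|phi phiM phib _ x]; first exact: joinN_min.
  by rewrite in_preimN => /DH; rewrite stableH.
suff H's : layered C n (set_slot (mixed H D' s) s H').
  apply: (layered_mono radC _ H's) => // i ilt; rewrite /set_slot /mixed ltnS leq_eqVlt.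
  by case: eqP => //= _; case: (i < s)%N.
apply: (gen (fun X => layered C n (set_slot (mixed H D' s) s X)))
  => [X Y|phi phiM phib D'phi]; first exact: layered_join.
apply: (layered_mono radC _ (layered_aut radC phiM phib HDs)) => // i ilt x.
rewrite in_preimN /set_slot /mixed; case: eqP => [->|_].
  by rewrite ltnn in_preimN.
case: ltnP => _; first by rewrite stableH.
by move/D'phi; rewrite in_preimN.
Qed.

Lemma mixed_iterates n s k N : (s < total_weight C n)%N ->
  has_index N k -> layered C n (fun _ => N) ->
  exists H D l,
    [/\ characteristic H,
        has_index D l /\ (log2 (l%:R : R) <= iter s (@index_bound R) (log2 k%:R))%R,
        subN D H & layered C n (mixed H D s)].
Proof.
move=> + Nk nN; elim: s => [|s IHs] st.
  (* With [s = 0] no slot holds the first subgroup; the whole group is a characteristic placeholder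
     containing [N]. *)
  exists (whole G), N, k; split=> // x _; exact: in_whole.
have [H [D [l [Hchar [Dl lk] DH HDs]]]] := IHs (ltnW st).
have [H' [D' [l' [H'char [D'l' l'l] _ D'H' HDs']]]] :=
  closure_step (ltnW st) Hchar Dl DH HDs.
exists H', D', l'; split=> //; split=> //=.
apply: Order.POrderTheory.le_trans l'l _; apply: index_bound_mono lk.
exact/log2_ge0/(has_index_gt0 Dl).
Qed.

Lemma large_characteristic_layered n k N :
  has_index N k -> layered C n (fun _ => N) ->
  exists H m,
    [/\ characteristic H, has_index H m, layered C n (fun _ => H) &
        (log2 (m%:R : R)
          <= iter (total_weight C n).-1 (@index_bound R) (log2 k%:R))%R].
Proof.
move=> Nk nN; have t0 := total_weight_gt0 C n.
have tlt : ((total_weight C n).-1 < total_weight C n)%N by rewrite prednK.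
have [H [D [l [Hchar [Dl lk] DH HDs]]]] := mixed_iterates tlt Nk nN.
(* The last of the t steps fills every slot, so [D'] is dropped. As [H'] contains [D], its index is
   bounded by that of [D], obtained after t - 1 steps. *)
have [H' [D' [l' [H'char _ DH' _ HDs']]]] := closure_step tlt Hchar Dl DH HDs.
have [m ml H'm] := index_le_has (index_le_mono DH' (has_index_le Dl)).
exists H', m; split=> //.
  by apply: (layered_mono radC _ HDs') => // i ilt; rewrite /mixed prednK // ilt.
apply: Order.POrderTheory.le_trans lk; apply: ler_log2 ml.
exact: has_index_gt0 H'm.
Qed.

End Iteration.

Theorem mainTheorem3 (R : realType) (G : groupType) (n : nat)
    (C : 'I_n -> factor_condition)
    (C_radical : forall i : 'I_n, is_radical (C i))
    (C_coradical : forall i : 'I_n, 0 < i -> is_coradical (C i))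
    (N : groupClosed G) (k : nat) (N_index : has_index N k)
    (A : nat -> normalClosed G) (A_series : series_of C N A) :
  exists (H : groupClosed G) (m : nat) (B : nat -> normalClosed G),
    [/\ characteristic H,
        has_index H m,
        series_of C H B
      & (log2 (m%:R : R)
         <= iter (\prod_(i < n) condition_weight (C i)).-1 (@index_bound R)
              (log2 k%:R))%R].
Proof.
case: A_series => A0 An _ AC.
(* Any value outside 'I_n is irrelevant; identities satisfy both class hypotheses. *)
pose C' i := if insub i is Some j then C j else Identity Letter.
have C'E (i : 'I_n) : C' i = C i by rewrite /C' valK.
have radC' i : is_radical (C' i) by rewrite /C'; case: insubP.
have corC' i : (0 < i)%N -> is_coradical (C' i).
  by rewrite /C'; case: insubP => // j _ <- /C_coradical.
(* [N] is given as a mere subgroup; [A n] has the same elements and is normal by its type. *)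
have Ak : has_index (A n) k by apply: eq_has_index N_index => x; rewrite An.
have nA : layered C' n (fun _ => A n).
  apply: layered_of_series => [x|i i_lt]; first by rewrite A0 => /eqP.
  by have := AC (Ordinal i_lt); rewrite -C'E.
have [H [m [Hchar Hm nH mk]]] := large_characteristic_layered R radC' corC' Ak nA.
have [B [B0 Bn Bmono BC]] := series_of_layered radC' corC' nH.
exists H, m, B; split=> //.
  split=> [x|x|i x|i]; rewrite ?Bn //; first exact: Bmono.
  by rewrite -C'E; apply: BC.
suff <- : total_weight C' n = (\prod_(i < n) condition_weight (C i))%N by [].
by apply: eq_bigr => i _; rewrite C'E.
Qed.
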